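(* Let $m,n\ge2$ be integers, let $X=\{1,\dots,m\}\times\{1,\dots,n\}$, let $\mathcal P=\{C_1,\dots,C_m\}$ with $C_i=\{i\}\times\{1,\dots,n\}$, and let $S=\langle E(\mathcal T(X,\mathcal P))\rangle$ be the idempotent-generated submonoid of $\mathcal T(X,\mathcal P)$. Put $$S_1=\{f\in\mathcal T(X,\mathcal P):\overline f=1,\ f_1,\dots,f_m\in\mathcal E_n\},$$ $$S_2=\{f\in\mathcal T(X,\mathcal P):\overline f\in\mathcal T_m\setminus\mathcal S_m\},$$ $$S_3=\{f\in\mathcal T(X,\mathcal P):\overline f\in\mathcal T_m\setminus\mathcal S_m,\ f_1,\dots,f_m\in\mathcal S_n\}.$$ Then $S$ is the disjoint union $S=S_1\sqcup S_2$, and $S_2=S_1S_3$. Further, (i) $S_1=\mathcal E_n^{(1)}\cdots\mathcal E_n^{(m)}$ is the internal direct product of $m$ isomorphic copies of $\mathcal E_n$; (ii) $S_2$ is isomorphic to $\mathcal T_n\wr(\mathcal T_m\setminus\mathcal S_m)$, a wreath product of $\mathcal T_n$ with $\mathcal T_m\setminus\mathcal S_m$; (iii) $S_3$ is isomorphic to $\mathcal S_n\wr(\mathcal T_m\setminus\mathcal S_m)$, a wreath product of $\mathcal S_n$ with $\mathcal T_m\setminus\mathcal S_m$; and (iv) $|S|=(n^n-n!+1)^m+n^{mn}(m^m-m!)$.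
   Context: Maps are written on the right of their arguments and composed from left to right. $\mathcal T_k$ is the monoid of all functions $\{1,\dots,k\}\to\{1,\dots,k\}$, $\mathcal S_k$ is the symmetric group, and $\mathcal E_k$ is the submonoid of $\mathcal T_k$ generated by its idempotents; by a known theorem of Howie, $\mathcal E_k=\{1\}\cup(\mathcal T_k\setminus\mathcal S_k)$. $E(M)$ denotes the set of idempotents of a monoid $M$ and $\langle U\rangle$ the submonoid generated by $U$. $\mathcal T(X,\mathcal P)$ is the monoid of all functions $f:X\to X$ such that for every $i$ there is a $j$ with $C_if\subseteq C_j$. Each $f\in\mathcal T(X,\mathcal P)$ is uniquely written $f=[f_1,\dots,f_m;\overline f]$ with $\overline f\in\mathcal T_m$ and $f_1,\dots,f_m\in\mathcal T_n$, where $(i,j)f=(i\overline f,jf_i)$; the product is $fg=[f_1g_{1\overline f},\dots,f_mg_{m\overline f};\overline f\,\overline g]$. For $g\in\mathcal T_n$ and $i\in\{1,\dots,m\}$, $g^{(i)}=[1,\dots,1,g,1,\dots,1;1]$ with $g$ in the $i$th position, and $U^{(i)}=\{g^{(i)}:g\in U\}$ for $U\subseteq\mathcal T_n$. For a monoid $T$ and a subsemigroup $A\subseteq\mathcal T_m$, the wreath product $T\wr A$ is the set $T^m\times A$ with product $(t_1,\dots,t_m;a)(u_1,\dots,u_m;b)=(t_1u_{1a},\dots,t_mu_{ma};ab)$. *)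

(* Defs.v *)
(* The set {1,...,k} is represented by 'I_k = {0,...,k-1}. *)
From HB Require Import structures.
From mathcomp Require Import all_boot.

Set Implicit Arguments.
Unset Strict Implicit.
Unset Printing Implicit Defensive.

Local Open Scope group_scope.

#[short(type="finMonoidType")]
HB.structure Definition FinMonoid := {M of Monoid M & Finite M}.

Section FiniteMonoids.

Variable M : finMonoidType.
Implicit Types A B U : {set M}.

Definition is_subsemigroup A : bool :=
  [forall x in A, forall y in A, x * y \in A].

Definition is_submonoid A : bool := (1 \in A) && is_subsemigroup A.

Lemma is_subsemigroupP A : reflect (mulg_closed A) (is_subsemigroup A).
Proof.
apply: (iffP forall_inP) => [AM x y xA yA|AM x xA].
  by have /forall_inP := AM x xA; apply.
by apply/forall_inP=> y; apply: AM.
Qed.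

Lemma is_submonoidP A : reflect (monoid_closed A) (is_submonoid A).
Proof. by apply: (iffP andP) => -[A1 /is_subsemigroupP AM]. Qed.

(* When A is a submonoid N of M, this is E(N). *)
Definition idempotents A : {set M} := [set e in A | e * e == e].

(* <U>, the least submonoid containing U.  It lies in every submonoid of M that
   contains U, hence does not depend on the ambient monoid. *)
Definition gen_submonoid U : {set M} :=
  \bigcap_(A : {set M} | is_submonoid A && (U \subset A)) A.

Definition setmul A B : {set M} := [set x * y | x in A, y in B].

(* B is the internal direct product of the submonoids A_i: multiplication
   (s_i)_i |-> \prod_i s_i is an isomorphism from the external direct product
   of the A_i (with the componentwise product of {ffun 'I_k -> M}) onto B. *)
Definition internal_direct_product (k : nat) (A : 'I_k -> {set M}) B : Prop :=
  let mult (s : {ffun 'I_k -> M}) : M := \prod_(i < k) s i in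
  [/\ forall i, is_submonoid (A i),
      is_submonoid B,
      {in family A &, {morph mult : s t / s * t}},
      {in family A &, injective mult}
    & mult @: family A = B].

End FiniteMonoids.

(* Isomorphism of semigroups lying in monoids M and N; only the values of phi
   on A matter.  Between submonoids this is monoid isomorphism, as a
   multiplicative bijection preserves the identity. *)
Definition isomorphic (M N : finMonoidType) (A : {set M}) (B : {set N}) : Prop :=
  is_subsemigroup A /\ is_subsemigroup B /\
  exists phi : M -> N,
    [/\ {in A &, {morph phi : x y / x * y}},
        {in A &, injective phi}
      & phi @: A = B].

(* The full transformation monoid of X, with maps composed left to right.  An
   alias of {ffun X -> X}, so that it does not inherit a pointwise product. *)
Definition trans (X : finType) : predArgType := {ffun X -> X}.

Identity Coercion ffun_of_trans : trans >-> finfun_of.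

Section Trans.

Variable X : finType.

HB.instance Definition _ := Finite.copy (trans X) {ffun X -> X}.

Definition trans_one : trans X := [ffun x => x].
Definition trans_mul (f g : trans X) : trans X := [ffun x => g (f x)].

Lemma trans_mulA : associative trans_mul.
Proof. by move=> f g h; apply/ffunP=> x; rewrite !ffunE. Qed.

Lemma trans_mul1 : left_id trans_one trans_mul.
Proof. by move=> f; apply/ffunP=> x; rewrite !ffunE. Qed.

Lemma trans_mulr1 : right_id trans_one trans_mul.
Proof. by move=> f; apply/ffunP=> x; rewrite !ffunE. Qed.

HB.instance Definition _ :=
  isMonoid.Build (trans X) trans_mulA trans_mul1 trans_mulr1.

Definition trans_preserving (P : {set {set X}}) : {set trans X} :=
  [set f : trans X | [forall A in P, exists B in P, f @: A \subset B]].

End Trans.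

Notation Tn k := (trans 'I_k).

Definition Sym (k : nat) : {set Tn k} := [set f : Tn k | injectiveb f].

Definition En (k : nat) : {set Tn k} := gen_submonoid (idempotents [set: Tn k]).

Definition wreath (T : finMonoidType) (m : nat) : predArgType :=
  ({ffun 'I_m -> T} * Tn m)%type.

Section Wreath.

Variables (T : finMonoidType) (m : nat).

HB.instance Definition _ :=
  Finite.copy (wreath T m) ({ffun 'I_m -> T} * Tn m)%type.

Definition wreath_one : wreath T m := ([ffun=> 1], 1).
Definition wreath_mul (v w : wreath T m) : wreath T m :=
  ([ffun i => v.1 i * w.1 (v.2 i)], v.2 * w.2).

Lemma wreath_mulA : associative wreath_mul.
Proof.
move=> [t a] [u b] [v c]; congr pair; last exact: mulgA.
by apply/ffunP=> i; rewrite !ffunE mulgA.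
Qed.

Lemma wreath_mul1 : left_id wreath_one wreath_mul.
Proof.
move=> [t a]; congr pair; last exact: mul1g.
by apply/ffunP=> i; rewrite !ffunE mul1g.
Qed.

Lemma wreath_mulr1 : right_id wreath_one wreath_mul.
Proof.
move=> [t a]; congr pair; last exact: mulg1.
by apply/ffunP=> i; rewrite !ffunE mulg1.
Qed.

HB.instance Definition _ :=
  isMonoid.Build (wreath T m) wreath_mulA wreath_mul1 wreath_mulr1.

(* B wr A = B^m x A, for a submonoid B of T and a subsemigroup A of T_m. *)
Definition wreath_product (B : {set T}) (A : {set Tn m}) : {set wreath T m} :=
  [set w : wreath T m | [forall i, w.1 i \in B] && (w.2 \in A)].

End Wreath.

Section UniformPartition.

Variables m n : nat.

Notation X := ('I_m * 'I_n)%type.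
Implicit Types (f : trans X) (t : 'I_m -> Tn n) (a : Tn m) (g : Tn n).

Definition block (i : 'I_m) : {set X} := [set x : X | x.1 == i].

Definition uniform_partition : {set {set X}} := [set block i | i : 'I_m].

Definition TXP : {set trans X} := trans_preserving uniform_partition.

(* [t_1, ..., t_m; a] *)
Definition bracket t a : trans X := [ffun x : X => (a x.1, t x.1 x.2)].

(* For f in T(X,P): the map f-bar, sending i to the j with C_i f \subset C_j
   (unique when n > 0), and the component f_i. *)
Definition fbar f : Tn m :=
  [ffun i => odflt i [pick j | f @: block i \subset block j]].
Definition fcomp f (i : 'I_m) : Tn n := [ffun j => (f (i, j)).2].

Lemma bracket_TXP t a : bracket t a \in TXP.
Proof.
rewrite inE; apply/forall_inP=> _ /imsetP[i _ ->].
apply/exists_inP; exists (block (a i)); first exact: imset_f.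
by apply/subsetP=> _ /imsetP[x /[!inE] /eqP xi ->]; rewrite ffunE /= xi.
Qed.

Lemma bracketK f : f \in TXP -> bracket (fcomp f) (fbar f) = f.
Proof.
rewrite inE => /forall_inP fP; apply/ffunP=> -[i j]; rewrite !ffunE /=.
have /exists_inP[_ /imsetP[k _ ->] fk] := fP _ (imset_f block (isT : i \in predT)).
case: pickP => [l fl|/(_ k)]; last by rewrite fk.
have : f (i, j) \in block l.
  by apply: (subsetP fl); apply: imset_f; rewrite inE.
by rewrite inE => /eqP <-; case: (f _).
Qed.

Lemma fbar_bracket t a : 0 < n -> fbar (bracket t a) = a.
Proof.
move=> n0; apply/ffunP=> i; rewrite !ffunE.
have ta : bracket t a (i, Ordinal n0) \in bracket t a @: block i.
  by apply: imset_f; rewrite inE.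
case: pickP => [l /subsetP/(_ _ ta)|/(_ (a i)) /negP[]].
  by rewrite inE ffunE => /eqP.
by apply/subsetP=> _ /imsetP[x /[!inE] /eqP xi ->]; rewrite ffunE /= xi.
Qed.

Lemma fcomp_bracket t a i : fcomp (bracket t a) i = t i.
Proof. by apply/ffunP=> j; rewrite !ffunE. Qed.

Lemma bracketM t a u b :
  bracket t a * bracket u b = bracket (fun i => t i * u (a i)) (a * b).
Proof. by apply/ffunP=> x; rewrite !ffunE. Qed.

(* g^(i) and U^(i) *)
Definition at_pos (i : 'I_m) g : trans X :=
  bracket (fun k => if k == i then g else 1) 1.
Definition set_at_pos (i : 'I_m) (U : {set Tn n}) : {set trans X} :=
  [set at_pos i g | g in U].

Definition S0 : {set trans X} := gen_submonoid (idempotents TXP).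

Definition S1 : {set trans X} :=
  [set f in TXP | (fbar f == 1) && [forall i, fcomp f i \in En n]].

Definition S2 : {set trans X} := [set f in TXP | fbar f \in ~: Sym m].

Definition S3 : {set trans X} :=
  [set f in TXP | (fbar f \in ~: Sym m) && [forall i, fcomp f i \in Sym n]].

End UniformPartition.

(* Main.v *)
(* By Howie's theorem every non-bijective a in T_m is a product of the rank
   m-1 idempotents [merge i j], which send i to j and fix all other points: if
   i a = j a, then a is [merge i j] times a map of larger rank, and once a
   permutation is reached it is absorbed one transposition at a time.

   Idempotents of T(X,P) lie in S1 or in S2, S1 is a submonoid and S2 an ideal,
   so S is contained in their union.  Conversely S1 is the product of its
   factors E_n^(i), and S2 = S1 S3 because by Howie's theorem each component
   f_i lies in E_n or in S_n.  It remains to see that [s; a] lies in S for a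
   singular and all s_i in S_n.  If i a = j a and e = merge i j, one obtains
   [s o e; e] by moving the blocks k <> i, one at a time, through the free block
   i with a twist s_k; then [s o e; e] [1; a] = [s o e; a], and multiplying on
   the left by an idempotent [1, .., g, .., 1; e] with g = s_i s_j^-1 at i
   corrects the i-th component. *)
Require Import Defs.
From mathcomp Require Import all_boot.
From mathcomp Require fingroup perm.

Set Implicit Arguments.
Unset Strict Implicit.
Unset Printing Implicit Defensive.

Local Open Scope group_scope.

(** * Generated submonoids and iterated set products *)

Section Submonoids.

Variable M : finMonoidType.
Implicit Types A U : {set M}.

Lemma gen_submonoid_closed U : monoid_closed (gen_submonoid U).
Proof.
split; first by apply/bigcapP=> A /andP[/is_submonoidP[]].
move=> x y /bigcapP Ux /bigcapP Uy; apply/bigcapP=> A AU.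
by have /andP[/is_submonoidP[_ AM] _] := AU; apply: AM; [apply: Ux|apply: Uy].
Qed.

Lemma sub_gen_submonoid U : U \subset gen_submonoid U.
Proof. by apply/bigcapsP=> A /andP[]. Qed.

Lemma gen_submonoid_sub U A :
  monoid_closed A -> U \subset A -> gen_submonoid U \subset A.
Proof. by move=> /is_submonoidP AM UA; apply: bigcap_inf; rewrite AM. Qed.

(** Since no index repeats, the factors chosen one by one can be glued into a single function
    [s]. *)
Lemma big_setmulP (I : eqType) (A : I -> {set M}) (r : seq I) (x : M) :
    uniq r ->
  reflect (exists2 s : I -> M,
             forall i, i \in r -> s i \in A i & x = \prod_(i <- r) s i)
          (x \in \big[@setmul M/[set 1]]_(i <- r) A i).
Proof.
elim: r x => [|i r IHr] x.
  move=> _; rewrite big_nil; apply: (iffP set1P) => [->|[s _ ->]];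
    last by rewrite big_nil.
  by exists (fun=> 1); rewrite ?big_nil.
rewrite big_cons /= => /andP[ir /IHr{}IHr].
apply: (iffP imset2P) => [[y z Ay /IHr[s As ->] ->]|[s As ->]].
  exists (fun k => if k == i then y else s k).
    move=> k; rewrite inE; case: eqP => [-> //|_] /=; exact: As.
  rewrite big_cons eqxx; congr (_ * _); apply: eq_big_seq => k kr.
  by case: eqP kr ir => // -> ->.
exists (s i) (\prod_(k <- r) s k); last by rewrite big_cons.
  by apply: As; rewrite mem_head.
by apply/IHr; exists s => // k kr; apply: As; rewrite inE kr orbT.
Qed.

End Submonoids.

(** The preimage of [gen_submonoid V] under [h] is a submonoid containing [U]. This carries products
    of idempotents of [Tn n] and [Tn m] over to [S0]. *)
Lemma gen_submonoid_morph (M N : finMonoidType) (h : M -> N)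
    (U : {set M}) (V : {set N}) :
    h 1 = 1 -> {morph h : x y / x * y} ->
    {in U, forall x, h x \in gen_submonoid V} ->
  {in gen_submonoid U, forall x, h x \in gen_submonoid V}.
Proof.
move=> h1 hM hU x; have [V1 VM] := gen_submonoid_closed V.
have /subsetP sU : gen_submonoid U \subset h @^-1: gen_submonoid V.
  apply: gen_submonoid_sub; last by apply/subsetP=> y /hU; rewrite inE.
  by split=> [|y z]; rewrite !inE ?h1 // hM; apply: VM.
by move=> /sU; rewrite inE.
Qed.

Section Transformations.

Variable X : finType.
Implicit Types f g : trans X.

Lemma transM f g x : (f * g) x = g (f x).
Proof. exact: ffunE. Qed.

Lemma trans1 x : (1 : trans X) x = x.
Proof. exact: ffunE. Qed.

End Transformations.

(** * Howie's theorem on products of idempotents *)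

Section Howie.

Variable m : nat.
Implicit Types (a b : Tn m) (i j k l : 'I_m).

Lemma SymP a : reflect (injective a) (a \in Sym m).
Proof. by rewrite inE; apply: injectiveP. Qed.

Lemma Sym1 : 1 \in Sym m.
Proof. by apply/SymP=> i j; rewrite !trans1. Qed.

(** By finiteness an injective [a] is onto, so every point is the image under [a] of a preimage;
    this carries injectivity of [a * b] over to [b]. *)
Lemma SymM a b : (a * b \in Sym m) = (a \in Sym m) && (b \in Sym m).
Proof.
apply/SymP/andP => [abI|[/SymP aI /SymP bI] i j]; last first.
  by rewrite !transM => /bI/aI.
have aI : injective a by move=> i j aij; apply: abI; rewrite !transM aij.
split; apply/SymP => // i j.
by rewrite -[i](f_invF aI) -[j](f_invF aI) -!transM => /abI ->.
Qed.

Lemma En_closed : monoid_closed (En m).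
Proof. exact: gen_submonoid_closed. Qed.

Lemma En1 : 1 \in En m.
Proof. by case: En_closed. Qed.

Lemma EnM a b : a \in En m -> b \in En m -> a * b \in En m.
Proof. by case: En_closed => _; apply. Qed.

Lemma idempotent_En a : a * a = a -> a \in En m.
Proof.
by move=> aa; apply: (subsetP (sub_gen_submonoid _)); rewrite !inE aa eqxx.
Qed.

Definition merge i j : Tn m := [ffun k => if k == i then j else k].

Lemma merge_id i j : merge i j * merge i j = merge i j.
Proof.
by apply/ffunP=> k; rewrite transM !ffunE; case: (eqVneq k i) => [_|/negPf->];
  rewrite ?if_same //; case: eqP.
Qed.

Lemma merge_absorb i j a : a i = a j -> merge i j * a = a.
Proof.
by move=> aij; apply/ffunP=> k; rewrite transM !ffunE; case: eqP => // ->.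
Qed.

Lemma merge_En i j : merge i j \in En m.
Proof. exact/idempotent_En/merge_id. Qed.

Section Permutations.

Import fingroup perm.

Lemma trans_perm1 : [ffun x => (1 : {perm 'I_m}) x] = 1 :> Tn m.
Proof. by apply/ffunP=> x; rewrite trans1 ffunE perm1. Qed.

(* Position i is free after [merge i j], so it can serve as the buffer for
   swapping k and l by moves of a single point. *)
Lemma merge_tperm_En i j k l :
  i != j -> merge i j * [ffun x => tperm k l x] \in En m.
Proof.
move=> ij; wlog li : k l / l != i.
  move=> W; have [li|] := eqVneq l i; last exact: W.
  have [ki|ki] := eqVneq k i; last by rewrite tpermC; apply: W.
  by rewrite li ki tperm1 trans_perm1 mulg1 merge_En.
have [->|ki] := eqVneq k i.
  rewrite (_ : _ * _ = merge i j * merge l i) ?EnM ?merge_En //.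
  apply/ffunP=> x; rewrite !transM !ffunE.
  have [_|xi] := eqVneq x i; case: tpermP => [e|->|/eqP e1 /eqP e2].
  - by rewrite e eqxx in ij.
  - by rewrite eqxx.
  - by rewrite (negPf e2).
  - by rewrite e eqxx in xi.
  - by rewrite eqxx.
  - by rewrite (negPf e2).
have [->|kl] := eqVneq k l.
  by rewrite tperm1 trans_perm1 mulg1 merge_En.
rewrite (_ : _ * _ = merge i j * merge k i * merge l k * merge i l);
  first by rewrite !EnM ?merge_En.
apply/ffunP=> x; rewrite !transM ![merge _ _ _]ffunE [LHS]ffunE.
set y := if x == i then j else x.
have yi : y != i by rewrite /y; case: ifP => [_|->] //; rewrite eq_sym.
case: tpermP => [->|->|/eqP yk /eqP yl].
- by rewrite eqxx (eq_sym i) (negPf li) eqxx.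
- by rewrite (eq_sym l) (negPf kl) eqxx (negPf ki).
- by rewrite (negPf yk) (negPf yl) (negPf yi).
Qed.

(** Induction on a factorization of [a] into transpositions. As [merge i j] is idempotent, one copy
    can be pushed past a transposition [t], where it becomes [merge (t i) (t j)]: the free point
    moves from [i] to [t i]. *)
Lemma merge_Sym_En a i j :
  a \in Defs.Sym m -> i != j -> merge i j * a \in En m.
Proof.
move=> /SymP aI; have -> : a = [ffun x => perm aI x].
  by apply/ffunP=> k; rewrite ffunE permE.
have [ts -> _] := prod_tpermP (perm aI).
elim: ts i j => [|[k l] ts IHts] i j ij.
  by rewrite big_nil trans_perm1 mulg1 merge_En.
rewrite big_cons /=; set s' := \prod_(t <- ts) _ in IHts *; set t := tperm k l.
have -> : merge i j * [ffun x => (t * s') x] =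
    (merge i j * [ffun x => t x]) * (merge (t i) (t j) * [ffun x => s' x]).
  apply/ffunP=> x; rewrite !transM !ffunE permM (inj_eq perm_inj).
  by case: (eqVneq x i) => [_|/negPf->]; rewrite ?if_same //; case: eqP.
by rewrite EnM ?merge_tperm_En ?IHts // (inj_eq perm_inj).
Qed.

End Permutations.

Lemma card_setC_imset a : a \notin Sym m -> #|~: (a @: 'I_m)| != 0%N.
Proof.
apply: contra; rewrite cards_eq0 => /eqP a0.
have /imset_injP aI : #|a @: 'I_m| == #|'I_m|.
  by rewrite -[_ @: _]setCK a0 setC0 cardsT.
by apply/SymP=> i j; apply: aI.
Qed.

(** Induction on a bound [c] for the number of points outside the image of [a]; the bound 0 would
    make [a] a permutation. *)
Lemma singular_En a : a \notin Sym m -> a \in En m.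
Proof.
move: {2}#|_| (leqnn #|~: (a @: 'I_m)|) => c.
elim: c a => [|c IHc] a ac aS; have := card_setC_imset aS.
  by rewrite -leqn0 ac.
rewrite -lt0n => /card_gt0P[p pa].
have [i [j ij aij]] : exists i, exists2 j, i != j & a i = a j.
  by apply/injectivePn; move: aS; rewrite inE.
(* Redirecting [i] to the missed point [p] loses no image point, since [j] still reaches [a i];
   hence [b] misses fewer points than [a]. *)
pose b : Tn m := [ffun k => if k == i then p else a k].
have -> : a = merge i j * b.
  apply/ffunP=> k; rewrite transM !ffunE.
  by case: (eqVneq k i) => [->|/negPf->] //; rewrite eq_sym (negPf ij).
have [bI|bS] := boolP (b \in Sym m).
  exact: merge_Sym_En.
rewrite EnM ?merge_En // IHc // -ltnS (leq_trans _ ac) //.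
rewrite (cardsD1 p (~: (a @: 'I_m))) pa ltnS.
apply/subset_leq_card/subsetP=> q; rewrite !inE => qb; apply/andP; split.
  by apply: contraNneq qb => ->; apply/imsetP; exists i; rewrite // ffunE eqxx.
apply: contra qb => /imsetP[k _ ->]; apply/imsetP.
have [->|ki] := eqVneq k i; last by exists k; rewrite // ffunE (negPf ki).
by exists j; rewrite // ffunE eq_sym (negPf ij).
Qed.

End Howie.

(** * Explicit form and size of [En] *)

(** The right-hand side is a submonoid by [SymM], and it contains all idempotents because an
    injective one is 1; the other inclusion is [singular_En]. *)
Lemma En_eq k : En k = 1 |: ~: Sym k.
Proof.
apply/eqP; rewrite eqEsubset; apply/andP; split; last first.
  apply/subsetP=> a /setU1P[->|]; first exact: En1.
  by rewrite inE; apply: singular_En.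
apply: gen_submonoid_sub.
  split=> [|a b]; first by rewrite !inE eqxx.
  rewrite !(in_setU1, in_setC) SymM negb_and.
  case/orP=> [/eqP->|->]; last by rewrite orbT.
  by rewrite mul1g => /orP[->|->]; rewrite ?orbT.
apply/subsetP=> a; rewrite inE in_setT in_setU1 in_setC => /eqP aa.
have [/SymP aI|_] := boolP (a \in Sym k); last by rewrite orbT.
by rewrite orbF; apply/eqP/ffunP=> i; apply: aI; rewrite -transM aa trans1.
Qed.

Lemma card_Sym k : #|Sym k| = k`!.
Proof. by rewrite card_inj_ffuns card_ord ffactnn. Qed.

Lemma card_SymC k : #|~: Sym k| = (k ^ k - k`!)%N.
Proof.
by rewrite -card_Sym -(addKn #|Sym k| #|~: _|) cardsC card_ffun !card_ord.
Qed.

Lemma card_En k : #|En k| = (k ^ k - k`! + 1)%N.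
Proof. by rewrite En_eq cardsU1 in_setC Sym1 card_SymC addnC. Qed.

Lemma SymC_subsemigroup k : is_subsemigroup (~: Sym k).
Proof. by apply/is_subsemigroupP=> a b; rewrite !in_setC SymM => /negPf->. Qed.

Lemma Sym_subsemigroup k : is_subsemigroup (Sym k).
Proof. by apply/is_subsemigroupP=> a b; rewrite SymM => -> ->. Qed.

(** * Bracket coordinates, wreath products and counting *)

Section Brackets.

Variables m n : nat.
Hypothesis n_gt0 : (0 < n)%N.

Implicit Types (f : trans ('I_m * 'I_n)%type) (t u : 'I_m -> Tn n).
Implicit Types (a b : Tn m) (g : Tn n) (A : {set Tn m}) (B : {set Tn n}).

Lemma eq_bracket t u a : t =1 u -> bracket t a = bracket u a.
Proof. by move=> tu; apply/ffunP=> x; rewrite !ffunE tu. Qed.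

Lemma bracket1 : bracket (fun=> 1) 1 = 1 :> trans ('I_m * 'I_n)%type.
Proof. by apply/ffunP=> -[i j]; rewrite trans1 ffunE !trans1. Qed.

(** Common shape of [S1], [S2] and [S3], so that the wreath isomorphism and the count are each
    proved once. *)
Definition bracket_set B A : {set trans ('I_m * 'I_n)%type} :=
  [set f in TXP m n | (fbar f \in A) && [forall i, fcomp f i \in B]].

Lemma bracket_setE B A t a :
  (bracket t a \in bracket_set B A) = (a \in A) && [forall i, t i \in B].
Proof.
rewrite inE bracket_TXP fbar_bracket //=; congr (_ && _).
by apply/eq_forallb => i; rewrite fcomp_bracket.
Qed.

Lemma bracket_setP B A f :
  reflect (exists t, exists2 a,
             a \in A & (forall i, t i \in B) /\ f = bracket t a)
          (f \in bracket_set B A).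
Proof.
apply: (iffP idP) => [|[t [a aA [/forallP tB ->]]]]; last first.
  by rewrite bracket_setE aA.
rewrite inE => /andP[/bracketK fE /andP[fA /forallP fB]].
by exists (fcomp f), (fbar f).
Qed.

Lemma S1_bracket : S1 m n = bracket_set (En n) [set 1].
Proof. by apply/setP=> f; rewrite !inE. Qed.

Lemma S2_bracket : S2 m n = bracket_set setT (~: Sym m).
Proof.
apply/setP=> f; rewrite !inE; congr (_ && _); rewrite -[LHS]andbT.
by congr (_ && _); apply/esym/forallP=> i; rewrite inE.
Qed.

Lemma mem_S2 t a : (bracket t a \in S2 m n) = (a \notin Sym m).
Proof. by rewrite [LHS]inE bracket_TXP fbar_bracket // in_setC. Qed.

(** By [SymM], a singular base map in either factor makes the base map of the product singular. *)
Lemma S2_ideal f f' : f \in TXP m n -> f' \in TXP m n ->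
  (f \in S2 m n) || (f' \in S2 m n) -> f * f' \in S2 m n.
Proof.
by move=> /bracketK<- /bracketK<-; rewrite bracketM !mem_S2 SymM negb_and.
Qed.

(** The product rule [bracketM] is the multiplication of the wreath product, so reading off
    coordinates is the isomorphism. *)
Lemma isomorphic_wreath B A : is_subsemigroup A -> is_subsemigroup B ->
  isomorphic (bracket_set B A) (wreath_product B A).
Proof.
move=> /is_subsemigroupP AM /is_subsemigroupP BM; split; [|split].
- apply/is_subsemigroupP=> _ _ /bracket_setP[t [a aA [tB ->]]]
      /bracket_setP[u [b bA [uB ->]]]; rewrite bracketM bracket_setE AM //=.
  by apply/forallP=> i; apply: BM; [apply: tB|apply: uB].
- apply/is_subsemigroupP=> -[t a] [u b]; rewrite !inE /=.
  move=> /andP[/forallP tB aA] /andP[/forallP uB bA]; rewrite AM // andbT.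
  by apply/forallP=> i; rewrite ffunE; apply: BM.
exists (fun f => ([ffun i => fcomp f i], fbar f)); split.
- move=> _ _ /bracket_setP[t [a aA [tB ->]]] /bracket_setP[u [b bA [uB ->]]].
  rewrite bracketM !fbar_bracket //; congr pair.
  by apply/ffunP=> i; rewrite !ffunE !fcomp_bracket.
- move=> _ _ /bracket_setP[t [a _ [_ ->]]] /bracket_setP[u [b _ [_ ->]]].
  rewrite !fbar_bracket // => -[/ffunP tu ->]; apply: eq_bracket => i.
  by have := tu i; rewrite !ffunE !fcomp_bracket.
apply/setP=> -[t a]; rewrite !inE /=; apply/imsetP/andP.
  case=> _ /bracket_setP[u [b bA [uB ->]]] [-> ->]; rewrite fbar_bracket //.
  by split=> //; apply/forallP=> i; rewrite ffunE fcomp_bracket.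
case=> tB aA; exists (bracket t a); first by rewrite bracket_setE aA.
rewrite fbar_bracket //; congr pair.
by apply/ffunP=> i; rewrite ffunE fcomp_bracket.
Qed.

Lemma card_bracket_set B A : #|bracket_set B A| = (#|B| ^ m * #|A|)%N.
Proof.
pose D : {set {ffun 'I_m -> Tn n} * Tn m} :=
  setX [set t in ffun_on (mem B)] A.
pose F (p : {ffun 'I_m -> Tn n} * Tn m) := bracket p.1 p.2.
have -> : bracket_set B A = F @: D.
  apply/setP=> f; apply/bracket_setP/imsetP.
    move=> [t [a aA [tB ->]]]; exists ([ffun i => t i], a); last first.
      by apply: eq_bracket => i; rewrite ffunE.
    by rewrite !inE /= aA andbT; apply/ffun_onP=> i; rewrite ffunE.
  move=> [[t a]]; rewrite !inE /= => /andP[/ffun_onP tB aA ->].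
  by exists t, a.
rewrite card_in_imset; last first.
  move=> [t a] [u b] _ _; rewrite /F /= => tu; congr pair; last first.
    by rewrite -(fbar_bracket t a n_gt0) tu fbar_bracket.
  by apply/ffunP=> i; rewrite -(fcomp_bracket t a) tu fcomp_bracket.
by rewrite cardsX cardsE card_ffun_on card_ord.
Qed.

(** * [S1] as an internal direct product *)

Lemma at_posM i : {morph @at_pos m n i : g h / g * h}.
Proof.
move=> g h; rewrite /at_pos bracketM mulg1; apply: eq_bracket => k.
by rewrite trans1; case: eqP; rewrite ?mulg1.
Qed.

Lemma at_pos1 i : at_pos i (1 : Tn n) = 1 :> trans ('I_m * 'I_n)%type.
Proof. by rewrite -bracket1; apply: eq_bracket => k; rewrite if_same. Qed.

Lemma at_posK i : cancel (at_pos i) (fun f => fcomp f i).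
Proof. by move=> g; rewrite fcomp_bracket eqxx. Qed.

Lemma prod_at_pos t : \prod_(i < m) at_pos i (t i) = bracket t 1.
Proof.
(* Factors at distinct positions do not interact: [r] lists the positions already filled, and all
   others still carry 1. *)
have E r : uniq r ->
    \prod_(i <- r) at_pos i (t i) =
    bracket (fun k => if k \in r then t k else 1) 1.
  elim: r => [_|i r IHr /andP[ir /IHr{}IHr]].
    by rewrite big_nil -bracket1; apply: eq_bracket.
  rewrite big_cons IHr bracketM mulg1; apply: eq_bracket => k.
  rewrite trans1 inE; have [->|_] := eqVneq k i; last by rewrite mul1g.
  by rewrite (negPf ir) mulg1.
rewrite E ?index_enum_uniq //.
by apply: eq_bracket => k; rewrite mem_index_enum.
Qed.

Lemma S1_submonoid : monoid_closed (S1 m n).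
Proof.
rewrite S1_bracket; split.
  by rewrite -bracket1 bracket_setE set11; apply/forallP=> i; apply: En1.
move=> _ _ /bracket_setP[t [_ /set1P-> [tE ->]]]
      /bracket_setP[u [_ /set1P-> [uE ->]]].
rewrite bracketM bracket_setE mulg1 set11; apply/forallP=> i.
by apply: EnM; [apply: tE|apply: uE].
Qed.

Lemma S1_direct_product :
  internal_direct_product (fun i : 'I_m => set_at_pos i (En n)) (S1 m n).
Proof.
(* The [i]th factor is determined by its own [i]th component, which turns families of factors into
   tuples over [En n]. *)
have famP (s : {ffun 'I_m -> trans ('I_m * 'I_n)%type}) :
    s \in family (fun i : 'I_m => mem (set_at_pos i (En n))) ->
    forall i, s i = at_pos i (fcomp (s i) i) /\ fcomp (s i) i \in En n.
  by move=> /familyP sE i; have /imsetP[g gE ->] := sE i; rewrite at_posK.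
have prodE s : s \in family (fun i : 'I_m => mem (set_at_pos i (En n))) ->
    \prod_(i < m) s i = bracket (fun i => fcomp (s i) i) 1.
  move=> sE; rewrite -prod_at_pos; apply: eq_bigr => i _.
  by case: (famP s sE i).
split.
- move=> i; apply/is_submonoidP; split.
    by rewrite -(at_pos1 i) imset_f ?En1.
  move=> _ _ /imsetP[g gE ->] /imsetP[h hE ->].
  by rewrite -at_posM imset_f // EnM.
- exact/is_submonoidP/S1_submonoid.
- move=> s t sE tE; rewrite (prodE s) // (prodE t) // bracketM mulg1.
  rewrite -prod_at_pos; apply: eq_bigr => i _; rewrite at_posM ffunE trans1.
  by congr (_ * _); [case: (famP s sE i)|case: (famP t tE i)].
- move=> s t sE tE; rewrite (prodE s) // (prodE t) // => st.
  apply/ffunP=> i; have [-> _] := famP s sE i; have [-> _] := famP t tE i.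
  have := fcomp_bracket (fun i => fcomp (s i) i) 1 i.
  by rewrite st fcomp_bracket => ->.
apply/setP=> f; rewrite S1_bracket; apply/imsetP/bracket_setP.
  move=> [s sE ->]; rewrite prodE //; exists (fun i => fcomp (s i) i), 1.
    exact: set11.
  by split=> // i; case: (famP s sE i).
move=> [t [_ /set1P-> [tE ->]]]; exists [ffun i => at_pos i (t i)].
  by apply/familyP=> i; rewrite ffunE imset_f.
by rewrite -prod_at_pos; apply: eq_bigr => i _; rewrite ffunE.
Qed.

Lemma S1_setmul :
  S1 m n = \big[@setmul (trans ('I_m * 'I_n)%type) / [set 1]]_(i < m)
             set_at_pos i (En n).
Proof.
have [_ _ _ _ <-] := S1_direct_product; apply/setP=> f.
apply/imsetP/big_setmulP; first exact: index_enum_uniq.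
  by move=> [s /familyP sE ->]; exists s => // i _; apply: sE.
move=> [s sE ->]; exists [ffun i => s i].
  by apply/familyP=> i; rewrite ffunE sE ?mem_index_enum.
by apply: eq_bigr => i _; rewrite ffunE.
Qed.

Lemma set_at_pos_isomorphic i : isomorphic (En n) (@set_at_pos m n i (En n)).
Proof.
split; [|split].
- by apply/is_subsemigroupP=> a b; apply: EnM.
- by have [/(_ i)/andP[]] := S1_direct_product.
exists (at_pos i); split=> //; first by move=> g h _ _; apply: at_posM.
by move=> g h _ _; apply: (can_inj (at_posK i)).
Qed.

(** * Factorization of [S2] *)

Lemma S2_S1_S3 : S2 m n = setmul (S1 m n) (S3 m n).
Proof.
have S3_bracket : S3 m n = bracket_set (Sym n) (~: Sym m) by [].
rewrite S1_bracket S2_bracket S3_bracket; apply/setP=> f.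
apply/bracket_setP/imset2P.
  move=> [t [a aS [_ ->]]].
  (* Singular components go to the left factor and bijective ones to the right; the other factor
     carries 1 at that position. *)
  exists (bracket (fun i => if t i \in Sym n then 1 else t i) 1)
         (bracket (fun i => if t i \in Sym n then t i else 1) a).
  - rewrite bracket_setE set11; apply/forallP=> i.
    by case: ifPn => [_|/singular_En]; rewrite ?En1.
  - rewrite bracket_setE aS; apply/forallP=> i.
    by case: ifP; rewrite ?Sym1.
  rewrite bracketM mul1g; apply: eq_bracket => i; rewrite trans1.
  by case: ifP; rewrite ?mul1g ?mulg1.
move=> [_ _ /bracket_setP[t [_ /set1P-> [_ ->]]]]
      /bracket_setP[u [b bS [_ ->]]] ->; rewrite bracketM mul1g.
by exists (fun i => t i * u ((1 : Tn m) i)), b => //; split=> // i; rewrite inE.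
Qed.

(** * Comparison of [S0] with [S1] and [S2] *)

Lemma S0_closed : monoid_closed (S0 m n).
Proof. exact: gen_submonoid_closed. Qed.

Lemma S0M f f' : f \in S0 m n -> f' \in S0 m n -> f * f' \in S0 m n.
Proof. by case: S0_closed => _; apply. Qed.

(** By [bracketM], the two conditions express idempotency in coordinates. *)
Lemma idempotent_S0 t a :
  a * a = a -> (forall i, t i * t (a i) = t i) -> bracket t a \in S0 m n.
Proof.
move=> aa tt; apply: (subsetP (sub_gen_submonoid _)).
by rewrite inE bracket_TXP bracketM aa; apply/eqP/eq_bracket.
Qed.

Lemma at_pos_S0 i g : g \in En n -> at_pos i g \in S0 m n.
Proof.
apply: gen_submonoid_morph; [exact: at_pos1|exact: at_posM|].
move=> h; rewrite !inE => /eqP hh; apply: idempotent_S0 => [|k].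
  by rewrite mulg1.
by rewrite trans1; case: ifP; rewrite ?mulg1.
Qed.

Lemma bracket_id_S0 a : a \in En m -> bracket (fun=> 1) a \in S0 m n.
Proof.
apply: gen_submonoid_morph; first exact: bracket1.
  by move=> b c; rewrite bracketM; apply: eq_bracket => i; rewrite mulg1.
move=> b; rewrite !inE => /eqP bb.
by apply: idempotent_S0 => // i; rewrite mulg1.
Qed.

(** Block [i] falls into block [j], which is fixed pointwise, so this is idempotent for every [g],
    even a permutation. This is how nontrivial permutations enter [S0]. *)
Lemma merge_shift_S0 i j g : i != j ->
  bracket (fun l => if l == i then g else 1) (merge i j) \in S0 m n.
Proof.
move=> ij; apply: idempotent_S0 => [|l]; first exact: merge_id.
rewrite ffunE; have [_|li] := eqVneq l i; last by rewrite (negPf li) mulg1.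
by rewrite eq_sym (negPf ij) mulg1.
Qed.

(* Carry block k to the free block i by one idempotent, and back by another. *)
Lemma merge_twist_at_S0 i j k g : i != j -> k != i ->
  bracket (fun l => if merge i j l == k then g else 1) (merge i j) \in S0 m n.
Proof.
move=> ij ki.
have -> : bracket (fun l => if merge i j l == k then g else 1) (merge i j) =
    bracket (fun l => if l == i then 1 else 1) (merge i j) *
    bracket (fun l => if l == k then g else 1) (merge k i) *
    bracket (fun l => if l == i then 1 else 1) (merge i k).
  rewrite !bracketM (_ : _ * _ * _ = merge i j).
    by apply: eq_bracket => l; rewrite !if_same mul1g mulg1.
  apply/ffunP=> l; rewrite !transM; set x := merge i j l.
  have xi : x != i by rewrite /x ffunE; case: ifPn; rewrite // [j == i]eq_sym.
  rewrite ![merge _ _ _]ffunE; have [->|xk] := eqVneq x k.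
    by rewrite eqxx.
  by rewrite (negPf xi).
by rewrite !S0M ?merge_shift_S0 // eq_sym.
Qed.

Lemma merge_twist_S0 i j t : i != j ->
  bracket (fun l => t (merge i j l)) (merge i j) \in S0 m n.
Proof.
move=> ij.
(* Multiply the single-block twists over [r], the blocks twisted so far; without repetition each
   block is twisted only once. *)
have E r : uniq r -> i \notin r ->
    bracket (fun l => if merge i j l \in r then t (merge i j l) else 1)
      (merge i j) \in S0 m n.
  elim: r => [_ _|k r IHr]; first exact: (bracket_id_S0 (merge_En i j)).
  move=> /andP[kr /IHr{}IHr]; rewrite inE negb_or => /andP[ik /IHr{}IHr].
  have ki : k != i by rewrite eq_sym.
  have := S0M (merge_twist_at_S0 (t k) ij ki) IHr; rewrite bracketM merge_id.
  move=> H; apply: etrans H; congr (_ \in S0 m n); apply: eq_bracket => l.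
  rewrite -transM merge_id inE; have [->|_] := eqVneq (merge i j l) k.
    by rewrite (negPf kr) mulg1.
  by rewrite mul1g.
(* Take all blocks except [i]: since [merge i j] never takes the value [i], the condition then
   always holds. *)
have := E (rem i (enum 'I_m)); rewrite rem_uniq ?enum_uniq //.
rewrite mem_rem_uniq ?enum_uniq // inE eqxx => /(_ isT isT).
move=> H; apply: etrans H; congr (_ \in S0 m n); apply: eq_bracket => l.
rewrite mem_rem_uniq ?enum_uniq // !inE mem_enum andbT ffunE.
by case: ifPn => [_|->//]; rewrite eq_sym ij.
Qed.

Lemma S3_sub_S0 t a :
  a \notin Sym m -> (forall i, t i \in Sym n) -> bracket t a \in S0 m n.
Proof.
move=> aS tS; have aE := singular_En aS.
have [i [j ij aij]] : exists i, exists2 j, i != j & a i = a j.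
  by apply/injectivePn; move: aS; rewrite inE.
have /SymP tjI := tS j.
pose g : Tn n := [ffun x => invF tjI (t i x)].
have gtj : g * t j = t i by apply/ffunP=> x; rewrite transM ffunE f_invF.
have -> : bracket t a =
    bracket (fun l => if l == i then g else 1) (merge i j) *
    (bracket (fun l => t (merge i j l)) (merge i j) * bracket (fun=> 1) a).
  rewrite !bracketM !(merge_absorb aij); apply: eq_bracket => l.
  rewrite mulg1 -transM merge_id ffunE.
  by have [->|_] := eqVneq l i; rewrite ?gtj ?mul1g.
by rewrite !S0M ?merge_shift_S0 ?merge_twist_S0 ?bracket_id_S0.
Qed.

Lemma S1_sub_S0 : S1 m n \subset S0 m n.
Proof.
rewrite S1_bracket; apply/subsetP=> _ /bracket_setP[t [_ /set1P-> [tE ->]]].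
have [S01 _] := S0_closed.
rewrite -prod_at_pos.
by elim/big_ind: _ => // [|i _]; [apply: S0M|apply: at_pos_S0].
Qed.

Lemma S0_eq : S0 m n = S1 m n :|: S2 m n.
Proof.
apply/eqP; rewrite eqEsubset subUset S1_sub_S0 /=.
apply/andP; split; last first.
  rewrite S2_S1_S3; apply/subsetP=> _ /imset2P[f f' fS1 f'S3 ->].
  apply: S0M; first exact: subsetP S1_sub_S0 _ fS1.
  move: f'S3 => /bracket_setP[t [a aS [tS ->]]]; apply: S3_sub_S0 => //.
  by move: aS; rewrite inE.
have [S1_1 S1M] := S1_submonoid.
apply: gen_submonoid_sub.
  (* For closure, a product with a factor in [S2] stays in [S2] by the ideal property; otherwise
     both factors lie in [S1]. *)
  split=> [|f f']; first by rewrite inE S1_1.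
  have sT : S1 m n :|: S2 m n \subset TXP m n.
    by apply/subsetP=> h; rewrite !in_set -andb_orr => /andP[].
  move=> fS f'S; have [fT f'T] := (subsetP sT _ fS, subsetP sT _ f'S).
  have [?|S2f] := boolP ((f \in S2 m n) || (f' \in S2 m n)).
    by rewrite inE S2_ideal ?orbT.
  move: S2f fS f'S; rewrite negb_or => /andP[/negPf f2 /negPf f'2].
  by rewrite !(in_setU _ (S1 m n)) f2 f'2 !orbF => fS f'S; rewrite S1M.
apply/subsetP=> f; rewrite inE => /andP[/bracketK <-].
set t := fcomp f; set a := fbar f; rewrite bracketM => /eqP E.
(* An idempotent has an idempotent base map, which is 1 or singular. If it is 1, the equation [E]
   says that each component is idempotent. *)
have aa : a * a = a.
  by rewrite -[RHS](fbar_bracket t _ n_gt0) -E fbar_bracket.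
have := idempotent_En aa; rewrite En_eq in_setU1 in_setC.
case/orP=> [/eqP a1|aS]; last by apply/setUP; right; rewrite mem_S2.
apply/setUP; left; rewrite S1_bracket bracket_setE a1 set11.
apply/forallP=> i; apply: idempotent_En.
by rewrite -[RHS](fcomp_bracket t a) -E fcomp_bracket a1 trans1.
Qed.

End Brackets.

Theorem proposition4p1 (m n : nat) (hm : (2 <= m)%N) (hn : (2 <= n)%N) :
  S0 m n = S1 m n :|: S2 m n
  /\ [disjoint S1 m n & S2 m n]
  /\ S2 m n = setmul (S1 m n) (S3 m n)
  /\ (S1 m n =
        \big[@setmul (trans ('I_m * 'I_n)%type) / [set 1]]_(i < m)
           set_at_pos i (En n)
      /\ internal_direct_product (fun i : 'I_m => set_at_pos i (En n)) (S1 m n)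
      /\ (forall i : 'I_m, isomorphic (En n) (set_at_pos i (En n))))
  /\ isomorphic (S2 m n) (wreath_product [set: Tn n] (~: Sym m))
  /\ isomorphic (S3 m n) (wreath_product (Sym n) (~: Sym m))
  /\ #|S0 m n|
       = ((n ^ n - n`! + 1) ^ m + n ^ (m * n) * (m ^ m - m`!))%N.
Proof.
have n0 : (0 < n)%N by apply: ltnW.
(* The base map 1 of an element of [S1] is a permutation. *)
have dis : [disjoint S1 m n & S2 m n].
  rewrite S1_bracket disjoint_subset.
  apply/subsetP=> _ /(bracket_setP n0)[t [_ /set1P-> [_ ->]]].
  by rewrite inE mem_S2 // negbK Sym1.
split; first exact: S0_eq.
split=> //; split; first exact: S2_S1_S3.
split; first by split; [exact: S1_setmul|split; [exact: S1_direct_product|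
  exact: set_at_pos_isomorphic]].
split.
  rewrite S2_bracket; apply: isomorphic_wreath (SymC_subsemigroup m) _ => //.
  by apply/is_subsemigroupP=> x y _ _; rewrite inE.
split.
  exact: isomorphic_wreath (SymC_subsemigroup m) (Sym_subsemigroup n).
rewrite S0_eq // cardsU disjoint_setI0 // cards0 subn0 S1_bracket S2_bracket.
rewrite !card_bracket_set // cards1 muln1 card_En card_SymC.
by rewrite cardsT card_ffun !card_ord -expnM [(n * m)%N]mulnC.
Qed.
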